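(* Let $U=\begin{pmatrix} A_{U} & B_{U}\\ C_{U} & D_{U}\end{pmatrix}$ and $V=\begin{pmatrix} A_{V} & B_{V}\\ C_{V} & D_{V}\end{pmatrix}$ be complex square block matrices of the same size, partitioned in the same way, with $A_U,A_V\in\mathbb{C}^{n\times n}$, $B_U,B_V\in\mathbb{C}^{n\times s}$, $C_U,C_V\in\mathbb{C}^{s\times n}$, $D_U,D_V\in\mathbb{C}^{s\times s}$. Assume that $A_{U}^{\#}$ and $A_{V}^{\#}$ exist, and let $K_{U}=D_{U}-C_{U}A_{U}^\# B_{U}$ and $K_{V}=D_{V}-C_{V}A_{V}^\# B_{V}$. Suppose that $R(B_{V})\subseteq R(A_{V})$, $R((A_{V}^\# B_{V})^* )\subseteq R(K_{V}^* )$, $R(C_{U}^* )\subseteq R(A_{U}^* )$ and $R(C_{U}A_{U}^\#)\subseteq R(K_{U})$. If $(U,V)$ is a group inverse absorbing pair, then $(K_{U},K_{V})$ is also a group inverse absorbing pair.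
   Context: $R(X)$ denotes the range (column space) of a matrix $X$ and $X^*$ its conjugate transpose. A square matrix $X$ is group invertible if there is a matrix $Y$ with $XYX=X$, $YXY=Y$ and $XY=YX$; such a $Y$ is unique, is called the group inverse of $X$, and is denoted $X^{\#}$. For square complex matrices $P,Q$ of the same size, the pair $(P,Q)$ is called a group inverse absorbing pair if both $P$ and $Q$ are group invertible and $P^\#+Q^\#=P^\#(P+Q)Q^\#$. *)

(* Defs.v *)
From HB Require Import structures.
From mathcomp Require Export all_boot all_order all_algebra.
From mathcomp Require Export spectral sesquilinear.
From mathcomp Require Export complex.
From mathcomp Require Export boolp classical_sets reals.

Set Implicit Arguments.
Unset Strict Implicit.
Unset Printing Implicit Defensive.

Import Order.TTheory GRing.Theory Num.Theory.

Local Open Scope classical_set_scope.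
Local Open Scope ring_scope.

(* Unlike the row spaces compared by (_ <= _)%MS, this is the column space. *)
Definition colspace (F : fieldType) (m n : nat) (X : 'M[F]_(m, n)) :
  set 'cV[F]_m := range (fun w : 'cV[F]_n => X *m w).

Definition is_ginv (F : fieldType) (n : nat) (X Y : 'M[F]_n) : Prop :=
  [/\ X *m Y *m X = X, Y *m X *m Y = Y & X *m Y = Y *m X].

Definition group_invertible (F : fieldType) (n : nat) (X : 'M[F]_n) : Prop :=
  exists Y : 'M[F]_n, is_ginv X Y.

(* Total: the value is 0 when X is not group invertible. *)
Definition ginv (F : fieldType) (n : nat) (X : 'M[F]_n) : 'M[F]_n :=
  xget 0 [set Y | is_ginv X Y].

Notation "X ^#" := (ginv X) (at level 3, format "X ^#") : ring_scope.

Definition ginv_absorbing_pair (F : fieldType) (n : nat) (P Q : 'M[F]_n) :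
    Prop :=
  [/\ group_invertible P, group_invertible Q &
      P^# + Q^# = P^# *m (P + Q) *m Q^#].

Lemma is_ginv_unique (F : fieldType) (n : nat) (X Y Z : 'M[F]_n) :
  is_ginv X Y -> is_ginv X Z -> Y = Z.
Proof.
move=> [XYX YXY XY] [XZX ZXZ XZ].
have E : X *m Y = X *m Z.
  transitivity (X *m Y *m (X *m Z)).
    by rewrite XZ XY -mulmxA; congr (_ *m _); rewrite mulmxA XZX.
  by rewrite mulmxA XYX.
by rewrite -YXY -mulmxA E mulmxA -XY E XZ ZXZ.
Qed.

Lemma ginvP (F : fieldType) (n : nat) (X : 'M[F]_n) :
  group_invertible X -> is_ginv X X^#.
Proof. exact: xgetPex. Qed.

(* Main.v *)
(**
Write P' and Q' for the group inverses. Multiplying P' + Q' = P'(P + Q)Q' by PP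
on the left and by QQ on the right shows that a group invertible pair is
absorbing iff ker Q is contained in ker P and R(Q) is contained in R(P).

The hypotheses on V say that B_V = A_V A_V' B_V and that A_V' B_V = Y K_V for
some Y. Hence x in ker K_V gives (0; x) in ker V, thus in ker U, and then K_U x = 0.
Moreover V (-A_V' B_V x; x) = (0; K_V x), so if K_V^2 x = 0 then this vector is
killed by V, hence is 0 as ker V^2 = ker V: K_V is group invertible. The statements
about U and about ranges are the transposes of these.
*)
Require Import Defs.
Set Implicit Arguments.
Unset Strict Implicit.
Unset Printing Implicit Defensive.
Import Order.TTheory GRing.Theory Num.Theory.
Local Open Scope sesquilinear_scope.
Local Open Scope classical_set_scope.
Local Open Scope ring_scope.

(** The width [p] is left free so that one test matrix, the cokernel of [Q], already yields the row
    space inclusion. *)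
Lemma submx_kerP (F : fieldType) (m1 m2 n : nat)
  (P : 'M[F]_(m1, n)) (Q : 'M[F]_(m2, n)) :
  (forall p (x : 'M[F]_(n, p)), Q *m x = 0 -> P *m x = 0) <-> (P <= Q)%MS.
Proof.
split=> [kerQP | /submxP[W ->] p x Qx0]; last by rewrite -mulmxA Qx0 mulmx0.
by rewrite submxE kerQP ?mulmx_coker.
Qed.

Lemma group_invertible_tr (F : fieldType) (n : nat) (X : 'M[F]_n) :
  group_invertible X -> group_invertible X^T.
Proof.
move=> [Y [XYX YXY XY]]; exists Y^T; split; rewrite -!trmx_mul.
- by rewrite mulmxA XYX.
- by rewrite mulmxA YXY.
- by rewrite XY.
Qed.

(** The kernel condition gives [X = W' *m (X *m X)], and a rank count gives [X = X *m X *m W]. Hence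
    [W' *m X = X *m W], and [W' *m X *m W] is the group inverse. *)
Lemma group_invertible_kerP (F : fieldType) (n : nat) (X : 'M[F]_n) :
  group_invertible X <->
  (forall p (x : 'M[F]_(n, p)), X *m X *m x = 0 -> X *m x = 0).
Proof.
split=> [[Y [XYX _ XY]] p x XXx0 | /submx_kerP sXXX].
  by rewrite -XYX XY -!mulmxA [X *m (X *m x)]mulmxA XXx0 mulmx0.
have rXX : \rank (X *m X) = \rank X.
  by apply/eqP; rewrite eqn_leq mxrankM_maxl mxrankS.
have /submxP[W' defX'] := sXXX.
(* The reverse inclusion always holds, so equality of ranks gives this one. *)
have sXXXt : (X^T <= (X *m X)^T)%MS.
  by rewrite -(geq_leqif (mxrank_leqif_sup _)) ?mxrank_tr ?rXX //
             trmx_mul submxMl.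
have /submxP[Wt defXt] := sXXXt.
have defX : X = X *m X *m Wt^T by apply: trmx_inj; rewrite trmx_mul trmxK.
set W := Wt^T in defX.
have WX : W' *m X = X *m W by rewrite [in LHS]defX !mulmxA -[W' *m X *m X]mulmxA -defX'.
have XY : X *m (W' *m X *m W) = X *m W by rewrite WX !mulmxA -defX.
have YX : W' *m X *m W *m X = W' *m X.
  by rewrite -[W' *m X *m W]mulmxA -WX -!mulmxA -defX'.
have XWX : X *m W *m X = X by rewrite -WX -mulmxA -defX'.
exists (W' *m X *m W); split.
- by rewrite XY.
- by rewrite YX WX -!mulmxA [X *m (W *m _)]mulmxA [X *m W *m _]mulmxA XWX.
- by rewrite XY YX.
Qed.

Lemma ginv_absorbing_pairP (F : fieldType) (n : nat) (P Q : 'M[F]_n) :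
  group_invertible P -> group_invertible Q ->
  ginv_absorbing_pair P Q <-> (P <= Q)%MS /\ (Q^T <= P^T)%MS.
Proof.
move=> giP giQ; have [PYP YPY PY] := ginvP giP; have [QZQ ZQZ QZ] := ginvP giQ.
rewrite /ginv_absorbing_pair.
set Y := P^# in PYP YPY PY *; set Z := Q^# in QZQ ZQZ QZ *.
have PPY : P *m P *m Y = P by rewrite -mulmxA PY mulmxA.
have ZQQ : Z *m Q *m Q = Q by rewrite -QZ.
split=> [[_ _ E] | [/submxP[W defP] /submxP[Wt defQt]]].
  split.
    (* Both sides acquire the term [P *m P *m Z]; cancelling it leaves [P = P *m Q *m Z], which is
       [P *m Z *m Q]. *)
    have /(congr1 (mulmx (P *m P))) := E.
    rewrite !mulmxDr !mulmxDl !mulmxDr !mulmxA PPY addrC => /addrI ->.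
    by rewrite -mulmxA QZ mulmxA submxMl.
  have /(congr1 (mulmx^~ (Q *m Q))) := E.
  rewrite mulmxDl mulmxDr !mulmxDl -!mulmxA [Z *m (Q *m Q)]mulmxA ZQQ.
  rewrite [Q *m Q in X in _ = X]lock addrC -lock => /addIr ->.
  by rewrite mulmxA -PY -mulmxA trmx_mul submxMl.
have defQ : Q = P *m Wt^T by apply: trmx_inj; rewrite trmx_mul trmxK.
split=> //.
(* [Z] has [Q] as left factor and [Y] has [P] as right factor, so these identities give
   [Y *m P *m Z = Z] and [Y *m Q *m Z = Y]. *)
have PQZ : P *m Q *m Z = P by rewrite defP -!mulmxA QZ [Q *m _]mulmxA QZQ.
have YPQ : Y *m P *m Q = Q by rewrite -PY defQ mulmxA PYP.
have YE : Y = Y *m Y *m P by rewrite -mulmxA -PY mulmxA YPY.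
have ZE : Z = Q *m Z *m Z by rewrite QZ ZQZ.
rewrite mulmxDr mulmxDl addrC; congr (_ + _).
  by rewrite [in RHS]ZE !mulmxA YPQ -ZE.
by rewrite [in RHS]YE -!mulmxA [P *m (Q *m Z)]mulmxA PQZ mulmxA -YE.
Qed.

Section SchurComplement.

Variables (F : fieldType) (n s : nat).
Variables (A A' : 'M[F]_n) (B : 'M[F]_(n, s)) (C : 'M[F]_(s, n)).
Variables (D : 'M[F]_s) (Y : 'M[F]_(n, s)).
Let K := D - C *m A' *m B.
Hypotheses (AAB : A *m A' *m B = B) (AB : A' *m B = Y *m K).

(** The section takes any [A'] satisfying the two hypotheses, so that it serves both for V and, with
    [AU^#^T], for the transpose of U. *)
Lemma schur_ker p (x : 'M[F]_(s, p)) :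
  K *m x = 0 -> block_mx A B C D *m col_mx 0 x = 0.
Proof.
move=> Kx0; have ABx0 : A' *m (B *m x) = 0 by rewrite mulmxA AB -mulmxA Kx0 mulmx0.
have Bx0 : B *m x = 0 by rewrite -AAB -!mulmxA ABx0 mulmx0.
have Dx0 : D *m x = 0.
  by rewrite -[D](subrK (C *m A' *m B)) mulmxDl Kx0 -!mulmxA ABx0 mulmx0 addr0.
by rewrite mul_block_col !mulmx0 !add0r Bx0 Dx0 col_mx0.
Qed.

Lemma schur_group_invertible :
  group_invertible (block_mx A B C D) -> group_invertible K.
Proof.
move=> /group_invertible_kerP kerV; apply/group_invertible_kerP => p x KKx0.
have Vv : block_mx A B C D *m col_mx (- (A' *m B *m x)) x = col_mx 0 (K *m x).
  rewrite mul_block_col !mulmxN !mulmxA AAB addNr.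
  by congr col_mx; rewrite mulmxBl addrC.
have: col_mx 0 (K *m x) = 0 :> 'M[F]_(n + s, p).
  by rewrite -Vv; apply: kerV; rewrite -mulmxA Vv schur_ker // mulmxA.
by rewrite -[RHS]col_mx0 => /eq_col_mx[].
Qed.

(** If [K *m x = 0], then [(0; x)] is killed by both block matrices; thus [B1 *m x] and [D1 *m x]
    vanish. *)
Lemma schur_submx (A1 A1' : 'M[F]_n) (B1 : 'M[F]_(n, s)) (C1 : 'M[F]_(s, n))
  (D1 : 'M[F]_s) :
  (block_mx A1 B1 C1 D1 <= block_mx A B C D)%MS ->
  (D1 - C1 *m A1' *m B1 <= K)%MS.
Proof.
move=> /submx_kerP sUV; apply/submx_kerP => p x /schur_ker /sUV.
rewrite mul_block_col !mulmx0 !add0r -[RHS]col_mx0 => /eq_col_mx[B1x0 D1x0].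
by rewrite mulmxBl D1x0 -!mulmxA B1x0 !mulmx0 subr0.
Qed.

End SchurComplement.

Lemma colspace_subP (F : fieldType) (m n p : nat)
  (X : 'M[F]_(m, n)) (Y : 'M[F]_(m, p)) :
  colspace X `<=` colspace Y -> exists W, X = Y *m W.
Proof.
move=> sXY; suff /submxP[W defXt] : (X^T <= Y^T)%MS.
  by exists W^T; apply: trmx_inj; rewrite trmx_mul trmxK.
(* Column [i] of [X] is the image of a basis vector, hence lies in the range of [Y]. *)
apply/row_subP => i; have [w _ Yw] : colspace Y (col i X).
  by apply: sXY; exists (delta_mx i 0); rewrite // colE.
by rewrite -tr_col -Yw trmx_mul submxMl.
Qed.

(** Inclusions of adjoint ranges become left factorizations, so only plain transposes are needed
    afterwards. *)
Lemma colspace_adj_subP (C : numClosedFieldType) (m n p : nat)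
  (X : 'M[C]_(m, n)) (Y : 'M[C]_(p, n)) :
  colspace (X^t*) `<=` colspace (Y^t*) -> exists W, X = W *m Y.
Proof.
move=> /colspace_subP[W defXt]; exists (W^t*).
by rewrite -[LHS]trmxCK defXt trmx_mul map_mxM trmxCK.
Qed.

Theorem theorem4p5 (R : realType) (n s : nat)
  (AU AV : 'M[R[i]]_n) (BU BV : 'M[R[i]]_(n, s))
  (CU CV : 'M[R[i]]_(s, n)) (DU DV : 'M[R[i]]_s)
  (U V : 'M[R[i]]_(n + s)) (KU KV : 'M[R[i]]_s)
  (defU : U = block_mx AU BU CU DU) (defV : V = block_mx AV BV CV DV)
  (ginvAU : group_invertible AU) (ginvAV : group_invertible AV)
  (defKU : KU = DU - CU *m AU^# *m BU)
  (defKV : KV = DV - CV *m AV^# *m BV)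
  (sub_BV : colspace BV `<=` colspace AV)
  (sub_AV : colspace ((AV^# *m BV)^t*) `<=` colspace (KV^t*))
  (sub_CU : colspace (CU^t*) `<=` colspace (AU^t*))
  (sub_AU : colspace (CU *m AU^#) `<=` colspace KU) :
  ginv_absorbing_pair U V -> ginv_absorbing_pair KU KV.
Proof.
move=> UV; have [giU giV _] := UV.
have [sUV sVU] := (ginv_absorbing_pairP giU giV).1 UV.
have [W defBV] := colspace_subP sub_BV.
have [Y defABV] := colspace_adj_subP sub_AV.
have [W' defCU] := colspace_adj_subP sub_CU.
have [Z defCAU] := colspace_subP sub_AU.
have [AVK _ _] := ginvP ginvAV; have [AUK _ _] := ginvP ginvAU.
have AABV : AV *m AV^# *m BV = BV by rewrite defBV !mulmxA AVK.
(* The hypotheses on U, transposed, are those of the Schur section for [U^T], where [CU^T] and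
   [BU^T] are the upper right and lower left blocks. *)
have ACUt : AU^T *m AU^#^T *m CU^T = CU^T.
  by rewrite -!trmx_mul defCU -mulmxA [AU *m (_ *m _)]mulmxA AUK.
have defKUt : KU^T = DU^T - BU^T *m AU^#^T *m CU^T.
  by rewrite defKU linearB /= !trmx_mul mulmxA.
have CAUt : AU^#^T *m CU^T = Z^T *m KU^T by rewrite -!trmx_mul defCAU.
have defUt : U^T = block_mx AU^T CU^T BU^T DU^T by rewrite defU tr_block_mx.
have defVt : V^T = block_mx AV^T CV^T BV^T DV^T by rewrite defV tr_block_mx.
have defKVt : KV^T = DV^T - BV^T *m AV^#^T *m CV^T.
  by rewrite defKV linearB /= !trmx_mul mulmxA.
have giKV : group_invertible KV.
  rewrite defKV in defABV *; apply: schur_group_invertible AABV defABV _.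
  by rewrite -defV.
have giKU : group_invertible KU.
  rewrite -[KU]trmxK; apply: group_invertible_tr.
  rewrite defKUt in CAUt *; apply: schur_group_invertible ACUt CAUt _.
  by rewrite -defUt; apply: group_invertible_tr.
apply/ginv_absorbing_pairP=> //; split.
  rewrite defKU; rewrite defKV in defABV *.
  by apply: (schur_submx (A1 := AU) AABV defABV); rewrite -defU -defV.
(* Transposition exchanges the roles: the kernel of [U^T] lies in that of [V^T], and [U^T] is the
   matrix satisfying the section hypotheses. *)
rewrite defKVt; rewrite defKUt in CAUt *.
by apply: (schur_submx (A1 := AV^T) ACUt CAUt); rewrite -defUt -defVt.
Qed.
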